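(* Let $f$ be an endomorphism of $(\mathbb{Q},\leqslant)$ and write $X=\operatorname{im} f$. Then: (i) if $X$ is finite, the $\mathscr{D}$-class of $f$ in $\operatorname{End}(\mathbb{Q},\leqslant)$ contains $\aleph_0$ many $\mathscr{L}$-classes; (ii) if $X$ is infinite, the $\mathscr{D}$-class of $f$ in $\operatorname{End}(\mathbb{Q},\leqslant)$ contains $2^{\aleph_0}$ many $\mathscr{L}$-classes.
   Context: $M=\operatorname{End}(\mathbb{Q},\leqslant)$ is the monoid, under composition, of all maps $f\colon\mathbb{Q}\to\mathbb{Q}$ such that $u\leqslant v$ implies $uf\leqslant vf$. Maps are written on the right, so $fg$ means first $f$, then $g$. Green's relations on $M$: $f\,\mathscr{L}\,g$ iff $Mf=Mg$; $f\,\mathscr{R}\,g$ iff $fM=gM$; $\mathscr{D}=\mathscr{L}\circ\mathscr{R}$ (an equivalence relation, each class of which is a union of $\mathscr{L}$-classes). *)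

(* Defs.v *)
From HB Require Import structures.
From mathcomp Require Import all_boot all_order all_algebra.
From mathcomp Require Import boolp classical_sets functions cardinality.

Set Implicit Arguments.
Unset Strict Implicit.
Unset Printing Implicit Defensive.

Local Open Scope classical_set_scope.

Section OrderEndomorphisms.
Context {d : Order.disp_t} (T : porderType d).

Definition ord_end := {omorphism T -> T}.

Lemma ord_end_ext (f g : ord_end) : f =1 g -> f = g.
Proof.
case: f g => [f [[hf]]] [g [[hg]]] /= /funext efg.
by case: _ / efg hg => hg; rewrite (Prop_irrelevance hf hg).
Qed.

Definition ord_end_id : ord_end := (idfun : {omorphism T -> T}).

(* Maps act on the right: the product f * g is "first f, then g". *)
Definition ord_end_mul (f g : ord_end) : ord_end :=
  (g \o f : {omorphism T -> T}).

HB.instance Definition _ := gen_eqMixin ord_end.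
HB.instance Definition _ := gen_choiceMixin ord_end.

Fact ord_end_mulA : associative ord_end_mul.
Proof. by move=> f g h; apply: ord_end_ext. Qed.
Fact ord_end_mul1g : left_id ord_end_id ord_end_mul.
Proof. by move=> f; apply: ord_end_ext. Qed.
Fact ord_end_mulg1 : right_id ord_end_id ord_end_mul.
Proof. by move=> f; apply: ord_end_ext. Qed.

HB.instance Definition _ := isSemigroup.Build ord_end ord_end_mulA.
HB.instance Definition _ :=
  Semigroup_isMonoid.Build ord_end ord_end_mul1g ord_end_mulg1.

End OrderEndomorphisms.

Section Green.
Context {M : monoidType}.
Implicit Types f g h : M.

Definition left_ideal f : set M := [set (h * f)%g | h in [set: M]].
Definition right_ideal f : set M := [set (f * h)%g | h in [set: M]].

Definition greenL f g : Prop := left_ideal f = left_ideal g.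
Definition greenR f g : Prop := right_ideal f = right_ideal g.
Definition greenD f g : Prop := exists h, greenL f h /\ greenR h g.

Definition Lclass f : set M := [set g | greenL f g].
Definition Dclass f : set M := [set g | greenD f g].

Definition Lclasses_in (A : set M) : set (set M) :=
  [set K | range Lclass K /\ K `<=` A].
End Green.

(* Main.v *)
(** Two endomorphisms are L-related iff they have the same image, so L-classes
    are counted by images: finite sets of rationals in case (i), arbitrary sets
    of rationals in case (ii).  Conversely, if [u] has a monotone left inverse
    then [f u] is R-related to [f], so that the L-class of [f u], whose image is
    the image of [X] under [u], lies in the D-class of [f].  If [X] is finite,
    translations [u] make these images cover all of Q, so there are infinitely
    many of them.  If [X] is infinite, it contains points [b n] surrounded by
    pairwise disjoint open intervals; for each set [S] of indices, let
    [u] be the identity except that, inside the [n]-th interval with [n] in [S],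
    it jumps over [b n].
    The resulting image of [X] contains [b n] iff [n] is not in [S], so [S] can
    be read off the L-class. *)
Require Import Defs.
From HB Require Import structures.
From mathcomp Require Import all_boot all_order all_algebra.
From mathcomp Require Import boolp classical_sets functions cardinality.
From mathcomp Require Import finmap lra.

Set Implicit Arguments.
Unset Strict Implicit.
Unset Printing Implicit Defensive.

Import Order.TTheory GRing.Theory Num.Theory.

Local Open Scope classical_set_scope.
Local Open Scope card_scope.

(** * Green's relations in an arbitrary monoid *)

Section GreenMonoid.
Context {M : monoidType}.
Implicit Types f g h u v : M.

Lemma greenLP f g :
  greenL f g <-> (exists u, f = (u * g)%g) /\ (exists u, g = (u * f)%g).
Proof.
split=> [fg|[[u fE] [v gE]]].
  split.
    have : left_ideal g f by rewrite -fg; exists 1%g => //; rewrite mul1g.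
    by move=> [u _ <-]; exists u.
  have : left_ideal f g by rewrite fg; exists 1%g => //; rewrite mul1g.
  by move=> [u _ <-]; exists u.
rewrite /greenL; apply/seteqP; split=> _ [h _ <-].
  by exists (h * u)%g => //; rewrite fE mulgA.
by exists (h * v)%g => //; rewrite gE mulgA.
Qed.

Lemma greenRP f g :
  greenR f g <-> (exists u, f = (g * u)%g) /\ (exists u, g = (f * u)%g).
Proof.
split=> [fg|[[u fE] [v gE]]].
  split.
    have : right_ideal g f by rewrite -fg; exists 1%g => //; rewrite mulg1.
    by move=> [u _ <-]; exists u.
  have : right_ideal f g by rewrite fg; exists 1%g => //; rewrite mulg1.
  by move=> [u _ <-]; exists u.
rewrite /greenR; apply/seteqP; split=> _ [h _ <-].
  by exists (u * h)%g => //; rewrite fE mulgA.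
by exists (v * h)%g => //; rewrite gE mulgA.
Qed.

(** One half of the commutation of L and R: with [g = s * h], left multiplication by [s] moves [f]
    inside its L-class to [s * f], which is R-related to [g]. *)
Lemma greenR_greenL_greenD f g h : greenR f h -> greenL h g -> greenD f g.
Proof.
move=> /greenRP[[u fE] [v hE]] /greenLP[[t hE'] [s gE]].
have fsf : (t * (s * f))%g = f by rewrite fE (mulgA s) -gE mulgA -hE'.
have gsfv : g = (s * f * v)%g by rewrite -mulgA -hE.
have sfgu : (s * f)%g = (g * u)%g by rewrite gE fE mulgA.
exists (s * f)%g; split; first by apply/greenLP; split; [exists t|exists s].
by apply/greenRP; split; [exists u|exists v].
Qed.

Lemma greenR_split_mono f u v : (f * u * v)%g = f -> greenR f (f * u)%g.
Proof. by move=> fuv; apply/greenRP; split; [exists v|exists u]. Qed.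

Lemma Lclass_in_Dclass f h :
  greenR f h -> Lclasses_in (Dclass f) (Lclass h).
Proof.
by move=> fh; split=> [|g hg]; [exists h | exact: greenR_greenL_greenD hg].
Qed.

Lemma mem_Lclass f : Lclass f f.
Proof. by []. Qed.

End GreenMonoid.

(** * Images and Green's relations for endomorphisms of a chain *)

Section GreenOrdEnd.
Local Open Scope order_scope.
Context {d : Order.disp_t} {T : orderType d}.
Implicit Types f g h : ord_end T.

Definition Ord_end (u : T -> T) (u_le : {homo u : x y / x <= y}) : ord_end T :=
  HB.pack u (Order.isOrderMorphism.Build _ _ _ _ u u_le).

(* A section of [g] over its range is automatically monotone. *)
Lemma ord_end_factor f g :
  range f `<=` range g -> exists h : ord_end T, f = (h * g)%g.
Proof.
move=> fg.
have /choice[s sP] z : exists y, range g z -> g y = z.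
  by have [[y _ <-]|gz] := pselect (range g z); [exists y | exists z].
have gs x : g (s (f x)) = f x by apply/sP/fg; exists x.
have s_le : {homo s \o f : x y / x <= y}.
  move=> x y xy /=; case: (leP (s (f x)) (s (f y))) => // sxy.
  have fxy : f x = f y.
    apply: le_anti; rewrite (omorph_le f xy) /= -(gs x) -(gs y).
    exact: omorph_le (ltW sxy).
  by move: sxy; rewrite fxy ltxx.
by exists (Ord_end s_le); apply: ord_end_ext => x; rewrite /= gs.
Qed.

Lemma range_ord_end_mul f g : range (f * g)%g = g @` range f.
Proof. by rewrite image_comp. Qed.

Lemma greenL_range f g : greenL f g <-> range f = range g.
Proof.
split=> [/greenLP[[u fE] [v gE]]|fg].
  by apply/seteqP; split; [rewrite fE | rewrite gE] => _ [x _ <-];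
    [exists (u x) | exists (v x)].
by apply/greenLP; split; apply: ord_end_factor; rewrite fg.
Qed.

Lemma Lclass_range f : Lclass f = [set g | range g = range f].
Proof.
by apply/seteqP; split=> g => [/greenL_range|gf]; last exact/greenL_range.
Qed.

Lemma Lclass_inj_range f g : Lclass f = Lclass g -> range f = range g.
Proof. by move=> fg; apply/greenL_range; have := mem_Lclass g; rewrite -fg. Qed.

(** An L-class is a fibre of [range], so [with_range] maps [B] onto a family containing every class
    counted. *)
Lemma card_Lclasses_in (A : set (ord_end T)) (B : set (set T)) :
  (forall f, A f -> B (range f)) -> Lclasses_in A #<= B.
Proof.
move=> AB.
pose with_range (Y : set T) := [set g : ord_end T | range g = Y].
apply: card_le_trans (card_image_le with_range B).
apply: subset_card_le => _ [[f _ <-] fA].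
by exists (range f); [exact/AB/fA/mem_Lclass | rewrite Lclass_range].
Qed.

(** L preserves the image, and right multiplication by [u] replaces it by its image under [u]. *)
Lemma finite_range_Dclass f g :
  finite_set (range f) -> greenD f g -> finite_set (range g).
Proof.
move=> f_fin [h [/greenL_range fh /greenRP[_ [u ->]]]].
by rewrite range_ord_end_mul -fh; exact: finite_image.
Qed.
End GreenOrdEnd.

(** * Gluing monotone maps along disjoint intervals *)

Section Glue.
Local Open Scope order_scope.
Context {d : Order.disp_t} {T : orderType d} {I : Type}.
Variables (a c : I -> T) (S : set I).
Hypothesis ac_disj : forall i j, i <> j -> c i <= a j \/ c j <= a i.
Implicit Types (f : I -> T -> T) (x y : T) (i : I).

Definition in_interval i x := S i /\ a i < x < c i.

(** The index is extracted by choice; disjointness of the intervals makes it unique. *)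
Definition glue f x : T :=
  if pselect (exists i, in_interval i x) is left e
  then f (projT1 (cid e)) x else x.

Lemma in_interval_inj i j x :
  a i < x < c i -> a j < x < c j -> i = j.
Proof.
move=> /andP[ax xc] /andP[ax' xc']; apply/not_notP => /ac_disj[] le_ca.
  by have := lt_trans (lt_le_trans xc le_ca) ax'; rewrite ltxx.
by have := lt_trans (lt_le_trans xc' le_ca) ax; rewrite ltxx.
Qed.

Lemma glue_in f i x : in_interval i x -> glue f x = f i x.
Proof.
move=> [Si xi]; rewrite /glue; case: pselect => [e|[]]; last by exists i.
by case: cid => j [_ xj] /=; rewrite (in_interval_inj xi xj).
Qed.

Lemma glue_out f x : ~ (exists i, in_interval i x) -> glue f x = x.
Proof. by rewrite /glue; case: pselect. Qed.

(** A value [f i x] stays between [a i] and [c i], and a point outside the selected intervals lies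
    on one side of each, so comparisons across pieces reduce to endpoints. *)
Lemma glue_le f :
    (forall i, {homo f i : x y / x <= y}) ->
    (forall i x, a i < x < c i -> a i <= f i x <= c i) ->
  {homo glue f : x y / x <= y}.
Proof.
move=> f_le f_ac x y xy.
have [[i xi]|xN] := pselect (exists i, in_interval i x);
  have [[j yj]|yN] := pselect (exists i, in_interval i y).
- rewrite (glue_in _ xi) (glue_in _ yj).
  have [->|/ac_disj[ca|ca]] := pselect (i = j); first exact: f_le.
    have /andP[_ h1] := f_ac _ _ xi.2; have /andP[h2 _] := f_ac _ _ yj.2.
    exact: le_trans h1 (le_trans ca h2).
  have /andP[ax _] := xi.2; have /andP[_ yc] := yj.2.
  by have := lt_trans (lt_le_trans (le_lt_trans xy yc) ca) ax; rewrite ltxx.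
- rewrite (glue_in _ xi) (glue_out _ yN).
  have /andP[_ h1] := f_ac _ _ xi.2; apply: le_trans h1 _.
  rewrite leNgt; apply/negP => yc; apply: yN; exists i; split; first exact: xi.1.
  by have /andP[ax _] := xi.2; rewrite yc (lt_le_trans ax xy).
- rewrite (glue_out _ xN) (glue_in _ yj).
  have /andP[h1 _] := f_ac _ _ yj.2; apply: le_trans _ h1.
  rewrite leNgt; apply/negP => ax; apply: xN; exists j; split; first exact: yj.1.
  by have /andP[_ yc] := yj.2; rewrite ax (le_lt_trans xy yc).
- by rewrite !glue_out.
Qed.

End Glue.

(** * Disjoint intervals around points of an infinite set *)

Section DisjointIntervals.
Local Open Scope order_scope.
Context {d : Order.disp_t} {T : orderType d}.
Implicit Types A B : set T.

(* One half [B] of [A] stays infinite; the points are taken in the other half,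
   so that intervals chosen later inside [B] are disjoint from (a, c). *)
Lemma infinite_split A : infinite_set A ->
  exists (B : set T) (a b c : T), [/\ infinite_set B /\ B `<=` A,
    [/\ A a, A b & A c], a < b < c &
    (forall x, B x -> x <= a) \/ (forall x, B x -> c <= x)].
Proof.
(* The third of five points cuts [A]; counting the cut itself, each side has three points to serve
   as [a < b < c] while the other side is the infinite one. *)
move=> A_inf; have [X XA X_card] := infinite_set_fset 5 A_inf.
have : {subset sort <=%O (X : seq T) <= X} by move=> x; rewrite mem_sort.
have := sort_lt_sorted (X : seq T); rewrite fset_uniq.
move: X_card; rewrite -(size_sort <=%O).
case: (sort _ _) => [|x1 [|x2 [|x3 [|x4 [|x5 s]]]]]//= _.
move=> /and5P[x12 x23 x34 x45 _] sX.
have xA x : x \in [:: x1, x2, x3, x4, x5 & s] -> A x by move=> /sX /XA.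
have [lo_fin|lo_inf] := pselect (finite_set (A `&` [set x | x <= x3])).
  exists (A `&` [set x | x3 <= x]), x1, x2, x3; split.
  - split=> [hi_fin|x []//]; apply: A_inf.
    apply: (@sub_finite_set _ _
        (A `&` [set x | x <= x3] `|` A `&` [set x | x3 <= x])).
      by move=> x Ax; case: (leP x x3) => [xx3|/ltW x3x]; [left | right].
    by rewrite finite_setU.
  - by split; apply: xA; rewrite !inE eqxx ?orbT.
  - by rewrite x12.
  - by right=> x [].
exists (A `&` [set x | x <= x3]), x3, x4, x5; split.
- by split=> // x [].
- by split; apply: xA; rewrite !inE eqxx ?orbT.
- by rewrite x34.
- by left=> x [].
Qed.

(** Iteration of [infinite_split]: the endpoints of all later intervals lie in [B n.+1], hence on
    one side of the [n]-th interval. *)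
Lemma disjoint_intervals A : infinite_set A ->
  exists a b c : nat -> T, [/\ forall n, A (b n), forall n, a n < b n < c n &
    forall m n, m <> n -> c m <= a n \/ c n <= a m].
Proof.
move=> A_inf; pose inf_set := {B : set T | infinite_set B}.
have /choice[F FP] (B : inf_set) : exists t : inf_set * (T * T * T),
    let: (B', (a, b, c)) := t in
    [/\ sval B' `<=` sval B, [/\ sval B a, sval B b & sval B c], a < b < c &
      (forall x, sval B' x -> x <= a) \/ (forall x, sval B' x -> c <= x)].
  have [B' [a [b [c [[B'_inf B'B] abcB abc B'ac]]]]] := infinite_split (svalP B).
  by exists (exist _ B' B'_inf, (a, b, c)).
pose B n := iter n (fst \o F) (exist _ A A_inf : inf_set).
pose a n := (F (B n)).2.1.1; pose b n := (F (B n)).2.1.2.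
pose c n := (F (B n)).2.2.
have P n : [/\ sval (B n.+1) `<=` sval (B n),
    [/\ sval (B n) (a n), sval (B n) (b n) & sval (B n) (c n)], a n < b n < c n &
    (forall x, sval (B n.+1) x -> x <= a n) \/
    (forall x, sval (B n.+1) x -> c n <= x)].
  by have := FP (B n); rewrite /a /b /c /=; case: (F (B n)) => [? [[? ?] ?]].
have B_sub m n : (m <= n)%N -> sval (B n) `<=` sval (B m).
  elim: n => [|n IHn]; first by rewrite leqn0 => /eqP->.
  rewrite leq_eqVlt => /predU1P[->//|/IHn BnBm]; have [Bn _ _ _] := P n.
  exact: subset_trans BnBm.
have disj m n : (m < n)%N -> c m <= a n \/ c n <= a m.
  move=> mn; have [_ [an _ cn] _ _] := P n; have [_ _ _ [lo|hi]] := P m.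
    by right; exact/lo/(B_sub _ _ mn).
  by left; exact/hi/(B_sub _ _ mn).
exists a, b, c; split=> [n|n|m n /eqP].
- by have [_ [_ + _] _ _] := P n; exact: (B_sub 0%N).
- by have [] := P n.
- by rewrite neq_ltn => /orP[/disj//|/disj[]]; [right | left].
Qed.
End DisjointIntervals.

(** * A piecewise affine jump over a point, and its retraction *)

Section Squeeze.
Local Open Scope ring_scope.
Context {F : realFieldType}.
Implicit Types a b c x y : F.

(* Affine contractions of (a, b] towards [a] and of (b, c) towards [c]: the image
   of (a, c) misses a half-open interval around [b], which [unsqueeze] collapses
   to [b]. *)
Definition squeeze a b c x : F := if x <= b then (a + x) / 2 else (x + c) / 2.

Definition unsqueeze a b c y : F := Num.min (2 * y - a) (Num.max b (2 * y - c)).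

Lemma squeeze_le a b c : a <= c -> {homo squeeze a b c : x y / x <= y}.
Proof. by rewrite /squeeze => ac x y xy; case: (leP x b); case: (leP y b); lra. Qed.

Lemma squeeze_in a b c x : a < x < c -> a < squeeze a b c x < c.
Proof. by rewrite /squeeze; case: (leP x b); lra. Qed.

(** The left branch ends at [(a + b) / 2 < b]; the right one stays above [(b + c) / 2 > b]. *)
Lemma squeeze_neq a b c x : a < b < c -> squeeze a b c x <> b.
Proof. by rewrite /squeeze; case: (leP x b) => ? ? /eqP; rewrite eq_le; lra. Qed.

Lemma unsqueeze_le a b c : {homo unsqueeze a b c : x y / x <= y}.
Proof.
move=> x y xy; rewrite /unsqueeze ge_min !le_min !le_max !ge_max.
lra.
Qed.

Lemma unsqueeze_in a b c y : a < b < c -> a < y < c ->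
  a <= unsqueeze a b c y <= c.
Proof. by rewrite /unsqueeze !(le_min, le_max, ge_min, ge_max); lra. Qed.

(** For [x <= b], [2 * y - a] returns [x] and the maximum is at least [b]; for [x > b], the maximum
    is [2 * y - c = x], and [a < c] makes the minimum select it. *)
Lemma squeezeK a b c : a < c -> cancel (squeeze a b c) (unsqueeze a b c).
Proof.
move=> ac x; apply/eqP; rewrite eq_le /unsqueeze /squeeze.
by case: (leP x b) => ?; rewrite !(le_min, le_max, ge_min, ge_max); lra.
Qed.
End Squeeze.

(** * Counting the L-classes in a D-class *)

Section CardLclasses.
Local Open Scope ring_scope.

Lemma card_le_of_inj {T U} (phi : T -> U) (B : set U) :
  injective phi -> range phi `<=` B -> [set: T] #<= B.
Proof.
move=> phi_inj /subset_card_le; apply: card_le_trans.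
have : range phi #= [set: T] by apply: inj_card_eq => ? ? _ _ /phi_inj.
by move=> /card_eqPle[].
Qed.

Lemma card_le_set_count (T : countType) : [set: set T] #<= [set: set nat].
Proof.
apply: (@card_le_of_inj _ _ (fun A : set T => choice.pickle @` A)) => // A B AB.
have pickle_inj := pcan_inj (@choice.pickleK T).
by apply/funext => x; rewrite -(image_inj pickle_inj) AB image_inj.
Qed.

Lemma punctured_embedding (F : realFieldType) (a b c : nat -> F) (S : set nat) :
    (forall n, a n < b n < c n) ->
    (forall m n, m <> n -> c m <= a n \/ c n <= a m) ->
  exists u v : ord_end F, [/\ (u * v)%g = 1%g,
    forall n, S n -> forall x, u x <> b n & forall n, ~ S n -> u (b n) = b n].
Proof.
move=> abc ac_disj.
have ac n : a n < c n by have /andP[] := abc n; exact: lt_trans.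
pose sq n := squeeze (a n) (b n) (c n).
pose unsq n := unsqueeze (a n) (b n) (c n).
have sq_le : {homo glue a c S sq : x y / x <= y}.
  apply: glue_le => // [n|n x /squeeze_in xac]; first exact/squeeze_le/ltW.
  by have /andP[/ltW -> /ltW ->] := xac (b n).
have unsq_le : {homo glue a c S unsq : x y / x <= y}.
  by apply: glue_le => // [n|n x xac]; [exact: unsqueeze_le | exact: unsqueeze_in].
(* Squeezing keeps a point in its own interval, so the second map applies the matching inverse
   there, and no point of another interval can reach [b n]. *)
have sq_in n x : in_interval a c S n x -> in_interval a c S n (sq n x).
  by move=> [Sn xac]; split=> //; exact: squeeze_in.
exists (Ord_end sq_le), (Ord_end unsq_le); split.
- apply: ord_end_ext => x /=.
  have [[n xn]|xN] := pselect (exists n, in_interval a c S n x).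
    by rewrite (glue_in _ _ xn)// (glue_in _ _ (sq_in _ _ xn))// /unsq /sq squeezeK.
  by rewrite !(glue_out _ xN).
- move=> n Sn x /=.
  have [[m xm]|xN] := pselect (exists n, in_interval a c S n x).
    rewrite (glue_in _ _ xm)// => sqx; have [_ ] := sq_in _ _ xm.
    rewrite sqx => /(in_interval_inj ac_disj (abc n)) nm.
    by move: sqx; rewrite -nm; exact: squeeze_neq.
  by rewrite (glue_out _ xN) => xb; apply: xN; exists n; rewrite xb.
- move=> n Sn /=; apply: glue_out => -[m [Sm bm]]; apply: Sn.
  by rewrite (in_interval_inj ac_disj (abc n) bm).
Qed.

Lemma card_Lclasses_infinite_range (F : realFieldType) (f : ord_end F) :
  infinite_set (range f) -> [set: set nat] #<= Lclasses_in (Dclass f).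
Proof.
move=> /disjoint_intervals[a [b [c [fb abc ac_disj]]]].
have /choice[u uP] S := punctured_embedding S abc ac_disj.
apply: (@card_le_of_inj _ _ (fun S => Lclass (f * u S)%g)) => [S S'|_ [S _ <-]].
  move=> /Lclass_inj_range fu; apply/funext => n.
  have memS R : range (f * u R)%g (b n) <-> ~ R n.
    have [v [_ uN uE]] := uP R; split=> [[x _ ux] Rn|/uE ub].
      exact: uN ux.
    by have [x _ fx] := fb n; exists x => //=; rewrite fx.
  (* The image records the complement of the index set, hence the double negations. *)
  by apply/propext; rewrite -[S n]notK -[S' n]notK -!memS fu.
have [v [uv _ _]] := uP S.
by apply/Lclass_in_Dclass/(@greenR_split_mono _ _ _ v); rewrite -mulgA uv mulg1.
Qed.

(** Every image in the D-class is finite, so finitely many L-classes would have images with finite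
    union, yet this union is all of the infinite field [F]. *)
Lemma infinite_Lclasses_finite_range (F : realFieldType) (f : ord_end F) :
  finite_set (range f) -> infinite_set (Lclasses_in (Dclass f)).
Proof.
move=> f_fin Lfin.
pose ranges (K : set (ord_end F)) : set F := [set x | exists2 g, K g & range g x].
have : finite_set (\bigcup_(K in Lclasses_in (Dclass f)) ranges K).
  apply: bigcup_finite => // _ [[g _ <-] gf].
  apply: sub_finite_set (finite_range_Dclass f_fin (gf _ (mem_Lclass g))).
  by move=> x [h /greenL_range ->].
apply: (@sub_infinite_set _ setT); last first.
  apply/infiniteP/(@card_le_of_inj _ _ (fun n => n%:R)) => // m n /eqP.
  by rewrite eqr_nat => /eqP.
(* The shift [x - f 0] is chosen to carry the value [f 0] to the prescribed point [x]. *)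
move=> x _; pose t (y : F) := y + (x - f 0); pose t' (y : F) := y - (x - f 0).
have t_le : {homo t : y z / y <= z} by move=> y z; rewrite /t lerD2r.
have t'_le : {homo t' : y z / y <= z} by move=> y z; rewrite /t' lerD2r.
exists (Lclass (f * Ord_end t_le)%g).
  apply/Lclass_in_Dclass/(@greenR_split_mono _ _ _ (Ord_end t'_le)).
  by apply: ord_end_ext => y /=; rewrite /t /t' addrK.
by exists (f * Ord_end t_le)%g => //; exists 0 => //=; rewrite /t addrC subrK.
Qed.
End CardLclasses.

Theorem theorem3p9 (f : ord_end rat) :
  (finite_set (range f) -> Lclasses_in (Dclass f) #= [set: nat]) /\
  (infinite_set (range f) -> Lclasses_in (Dclass f) #= [set: set nat]).
Proof.
split=> [f_fin|f_inf].
  apply: eq_card_nat; last exact: infinite_Lclasses_finite_range.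
  (* The possible images are finite subsets of a countable set, and these form a countable
     family. *)
  apply: sub_countable (countable_finite_subset (countableP [set: rat])).
  by apply: card_Lclasses_in => g fg; split=> //; exact: finite_range_Dclass fg.
(* Cantor-Bernstein; the upper bound allows every subset of [rat] as an image. *)
apply/card_eqPle; split; last exact: card_Lclasses_infinite_range.
apply: card_le_trans (card_le_set_count rat).
exact: card_Lclasses_in.
Qed.
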